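(* Let $(K,v)$ be a perfect valued field of rank one with $\operatorname{char}K=p$ an odd prime, and let $(F|K,w)$ be an immediate extension of valued function fields of transcendence degree one. Assume that $K=K^r$. Let $X\in F\setminus K$ be a separating transcendental element of $F|K$, and set $I:=IC(K(X)|K,w)$ and $\widetilde I:=IC(F|K,w)$. Then $\widetilde I|I$ is a finite extension.
   Context: $(F|K,w)$ is a finitely generated field extension of transcendence degree one with a valuation $w$ on $F$ extending $v$; immediate means $wF=vK$ and $Fw=Kv$. A separating transcendental element is an $X\in F$ transcendental over $K$ with $F|K(X)$ finite separable. Fix an extension of $w$ to an algebraic closure $\overline F$, again denoted $w$; its restriction to $\overline K\subset\overline F$ is denoted $v$. Henselizations $E^h$ are taken inside $\overline F$ with respect to this extension. Implicit constant fields: $IC(K(X)|K,w):=\overline K\cap K(X)^h$ and $IC(F|K,w):=\overline K\cap F^h$. Absolute ramification field: $G^r:=\{\sigma\in\mathrm{Gal}(\overline K|K)\mid v(\sigma a-a)>va\ \text{for all } a\in\overline K\setminus\{0\}\}$ and $K^r$ is the fixed field of $G^r$ in $\overline K$. *)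

(* Defs.v *)
From HB Require Import structures.
From mathcomp Require Import all_boot all_order all_algebra all_field.
From mathcomp Require Import boolp classical_sets functions.

Set Implicit Arguments.
Unset Strict Implicit.
Unset Printing Implicit Defensive.

Import Order.TTheory GRing.Theory Num.Theory.

Local Open Scope classical_set_scope.
Local Open Scope ring_scope.

(* Totally ordered abelian groups, written additively. *)
HB.mixin Record POrderedZmodule_isTotalGroup G & Num.POrderedZmodule G := {
  ozmod_le_total : forall x y : G, (x <= y) || (y <= x);
  ozmod_le_add2l : forall z x y : G, x <= y -> z + x <= z + y
}.

#[short(type="orderedZmodType")]
HB.structure Definition OrderedZmodule :=
  { G of POrderedZmodule_isTotalGroup G & Num.POrderedZmodule G }.

(* [option G] is the ordered monoid G together with a largest element,
   infinity = None. *)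
Section WithInfinity.
Variable G : orderedZmodType.
Implicit Types a b : option G.

Definition vle a b : bool :=
  match a, b with
  | _, None => true
  | None, Some _ => false
  | Some x, Some y => x <= y
  end.

Definition vlt a b : bool := ~~ vle b a.

Definition vmin a b : option G := if vle a b then a else b.

Definition vadd a b : option G :=
  match a, b with
  | Some x, Some y => Some (x + y)
  | _, _ => None
  end.

End WithInfinity.

Record valuation (L : fieldType) (G : orderedZmodType) := Valuation {
  val_fun :> L -> option G;
  val_infty : forall x, val_fun x = None <-> x = 0;
  val_mul : forall x y, val_fun (x * y) = vadd (val_fun x) (val_fun y);
  val_add : forall x y, vle (vmin (val_fun x) (val_fun y)) (val_fun (x + y))
}.

(* All fields below are subfields of one ambient field L, given as subsets. *)
Section Fields.
Variable L : fieldType.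
Implicit Types (E M S : set L) (x : L) (p : {poly L}).

Definition subfield E : Prop := GRing.divring_closed (mem E).

(* The subfield E(S). *)
Definition adjoin E S : set L := smallest subfield (E `|` S).

Definition algebraic_over E x : Prop :=
  exists p, [/\ p \is a polyOver (mem E), p != 0 & root p x].

(* The relative algebraic closure of E in L; it is an algebraic closure of E
   when L is algebraically closed. *)
Definition alg_closure E : set L := [set x | algebraic_over E x].

Definition is_minpoly E x p : Prop :=
  [/\ p \is a polyOver (mem E), p \is monic, root p x
    & forall q, q \is a polyOver (mem E) -> q != 0 -> root q x ->
        (size p <= size q)%N].

Definition separable_over E x : Prop :=
  exists2 p, is_minpoly E x p & separable_poly p.

Definition sep_closure E : set L := [set x | separable_over E x].

(* Every algebraic extension of E is separable; meaningful when L is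
   algebraically closed. *)
Definition perfect E : Prop := alg_closure E `<=` sep_closure E.

(* M is an extension of E which is finite dimensional as an E-vector space. *)
Definition finite_ext E M : Prop :=
  E `<=` M /\
  exists (n : nat) (b : 'I_n -> L),
    (forall i, M (b i)) /\
    (forall x, M x ->
       exists2 c : 'I_n -> L, (forall i, E (c i)) & x = \sum_i c i * b i).

Definition finitely_generated E M : Prop :=
  exists s : seq L, M = adjoin E [set` s].

Definition trdeg_one E M : Prop :=
  exists t, [/\ M t, ~ algebraic_over E t
              & M `<=` alg_closure (adjoin E [set t])].

Definition function_field_one E M : Prop :=
  [/\ subfield E, subfield M, E `<=` M, finitely_generated E M
    & trdeg_one E M].

Definition separating_element E M x : Prop :=
  [/\ M x, ~ algebraic_over E x, finite_ext (adjoin E [set x]) M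
    & M `<=` sep_closure (adjoin E [set x])].

(* Gal(M|E). An automorphism of M is represented by any function L -> L
   inducing it on M; the values outside of M are irrelevant. *)
Definition galois_group M E : set (L -> L) :=
  [set s | [/\ set_bij M M s,
               (forall x y, M x -> M y -> s (x + y) = s x + s y),
               (forall x y, M x -> M y -> s (x * y) = s x * s y)
             & (forall x, E x -> s x = x)]].

Definition fixed_field M (H : set (L -> L)) : set L :=
  [set x | M x /\ forall s, H s -> s x = x].

End Fields.

Section ValuedFields.
Variables (L : fieldType) (G : orderedZmodType) (w : valuation L G).
Implicit Types (E M : set L) (x : L).

Definition value_group E : set G :=
  [set g | exists2 x, E x & w x = Some g].

(* The residue class of x in the residue field of (L,w). *)
Definition residue x : set L := [set y | vlt (Some 0) (w (y - x))].

(* The residue field of (E,w), inside the residue field of (L,w), whose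
   elements are cosets of the maximal ideal. *)
Definition residue_field E : set (set L) :=
  residue @` [set x | E x /\ vle (Some 0) (w x)].

Definition immediate E M : Prop :=
  value_group M = value_group E /\ residue_field M = residue_field E.

Definition is_subgroup (H : set G) : Prop :=
  GRing.zmod_closed (mem H).

Definition convex_subgroup (H A : set G) : Prop :=
  [/\ is_subgroup H, H `<=` A
    & forall g h : G, A g -> H h -> 0 <= g -> g <= h -> H g].

(* The rank is the number of proper convex subgroups of the value group; it is
   one when the value group is nontrivial and has no convex subgroups other
   than {0} and itself. *)
Definition rank_one E : Prop :=
  value_group E <> [set 0] /\
  forall H, convex_subgroup H (value_group E) ->
    H = [set 0] \/ H = value_group E.

Definition ramification_group E : set (L -> L) :=
  [set s | galois_group (alg_closure E) E s /\
     forall a, alg_closure E a -> a <> 0 -> vlt (w a) (w (s a - a))].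

(* E^r *)
Definition ramification_field E : set L :=
  fixed_field (alg_closure E) (ramification_group E).

Definition decomposition_group E : set (L -> L) :=
  [set s | galois_group (alg_closure E) E s /\
     forall a, alg_closure E a -> w (s a) = w a].

(* E^h, with respect to the given w: the decomposition field of the separable
   closure of E. Restriction identifies Gal(alg_closure E | E) with
   Gal(sep_closure E | E), compatibly with decomposition groups; the fixed
   field has to be taken in the separable closure, since in the algebraic
   closure it would be the perfect hull of E^h. *)
Definition henselization E : set L :=
  fixed_field (sep_closure E) (decomposition_group E).

(* IC(M|E,w) *)
Definition implicit_constant_field E M : set L :=
  alg_closure E `&` henselization M.

End ValuedFields.

(* Main.v *)
(* Put M = K(X), with decomposition groups D(M) and D(F). Since F|M is finite,
   D(F) has finite index m in D(M). As K is perfect, the algebraic closure C of K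
   is separable over M and over F, so IC(M|K,w) and IC(F|K,w) are the fixed
   fields of D(M) and D(F) in C. Artin's argument then bounds
   [IC(F|K,w) : IC(M|K,w)] by m. *)
Require Import Defs.
From HB Require Import structures.
From mathcomp Require Import all_boot all_order all_algebra all_field.
From mathcomp Require Import boolp classical_sets functions.

Set Implicit Arguments.
Unset Strict Implicit.
Unset Printing Implicit Defensive.

Import GRing.Theory.

Local Open Scope classical_set_scope.
Local Open Scope ring_scope.

(** * Subfields as field types; algebraic and separable elements *)

Section SubfieldType.
Variables (L : fieldType) (E : set L) (hE : subfield E).

(* [mem E] under a name that carries the closure proof, so that canonical
   instances can be attached to it. *)
Definition in_subfield of subfield E : {pred L} := mem E.

Lemma in_subfieldE x : (x \in in_subfield hE) = (x \in E).
Proof. by []. Qed.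

HB.instance Definition _ :=
  GRing.isDivringClosed.Build L (in_subfield hE) hE.

(** A genuine field type for [E]: polynomial division, matrix inversion and [algebraicOver] take
    place there, and [val] carries the results back to [L]. *)
Inductive subfield_type := Subfield_elem x & x \in in_subfield hE.
Definition subfield_val u := let: Subfield_elem x _ := u in x.

HB.instance Definition _ := [isSub for subfield_val].
HB.instance Definition _ := [Choice of subfield_type by <:].
HB.instance Definition _ :=
  [SubChoice_isSubIntegralDomain of subfield_type by <:].
HB.instance Definition _ :=
  [SubIntegralDomain_isSubField of subfield_type by <:].

Lemma polyOver_coefP (p : {poly L}) :
  reflect (forall i, E p`_i) (p \is a polyOver (mem E)).
Proof.
by apply: (iffP (@polyOverP _ (in_subfield hE) p)) => pE i;
  have := pE i; rewrite in_subfieldE inE.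
Qed.

Lemma subfield_polyOverP (p : {poly L}) :
  reflect (exists q : {poly subfield_type}, p = map_poly val q)
          (p \is a polyOver (mem E)).
Proof.
apply: (iffP (polyOver_coefP _)) => [pE|[q ->] i]; last first.
  by rewrite coef_map -inE; exact: (valP q`_i).
(* The default [0] is never taken, since every coefficient lies in [E]. *)
exists (\poly_(i < size p) (insubd (0 : subfield_type) p`_i)).
apply/polyP => i; rewrite coef_map coef_poly.
case: ltnP => [_|le_p_i]; last by rewrite raddf0 nth_default.
by rewrite /= val_insubd in_subfieldE mem_set.
Qed.

Lemma algebraic_overE (x : L) :
  algebraic_over E x <->
  algebraicOver (val : subfield_type -> L) x.
Proof.
split=> [[p [/subfield_polyOverP [q ->] q0 qx]]|[q q0 qx]].
  by exists q => //; rewrite -(map_poly_eq0 (val : {rmorphism _ -> _})).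
exists (map_poly val q); split=> //; last by rewrite map_poly_eq0.
by apply/subfield_polyOverP; exists q.
Qed.

(** The remainder of [q] modulo [p] vanishes at [x] and has smaller degree than [p]. Dividing over
    [subfield_type] keeps its coefficients in [E], so minimality forces it to be zero. *)
Lemma is_minpoly_dvdp (x : L) (p q : {poly L}) :
  is_minpoly E x p -> q \is a polyOver (mem E) -> root q x -> p %| q.
Proof.
move=> [/subfield_polyOverP [p' ->] p_monic px min_p].
move=> /subfield_polyOverP [q' ->] qx.
rewrite dvdp_map; apply/modp_eq0P/eqP/contraT => r_neq0.
have r0 : map_poly (val : subfield_type -> L) (q' %% p') != 0.
  by rewrite map_poly_eq0.
have := min_p (map_poly val (q' %% p')).
have rx : root (map_poly val (q' %% p')) x.
  move: qx; rewrite map_modp.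
  rewrite [X in root X _](divp_eq _ (map_poly val p')).
  by rewrite !rootE hornerD hornerM (rootP px) mulr0 add0r.
have rE : map_poly val (q' %% p') \is a polyOver (mem E).
  by apply/subfield_polyOverP; exists (q' %% p').
move=> /(_ rE r0 rx); rewrite !size_map_poly leqNgt ltn_modp.
by rewrite -(map_poly_eq0 (val : {rmorphism subfield_type -> L})) monic_neq0.
Qed.

Lemma is_minpoly_exists (x : L) :
  algebraic_over E x -> exists p, is_minpoly E x p.
Proof.
move=> [p0 [p0E p0_neq0 p0x]].
pose P n := `[< exists p : {poly L}, [/\ p \is a polyOver (mem E), p != 0,
  root p x & size p = n] >].
have exP : exists n, P n by exists (size p0); apply/asboolP; exists p0.
case: (ex_minnP exP) => n /asboolP [p [pE p_neq0 px sp]] min_n.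
exists ((lead_coef p)^-1 *: p); split.
- apply: (@polyOverZ _ (in_subfield hE)) => //.
  by rewrite rpredV in_subfieldE mem_set //; apply/polyOver_coefP.
- by rewrite monicE lead_coefZ mulVf ?lead_coef_eq0.
- by rewrite rootE hornerZ (rootP px) mulr0.
move=> q qE q0 qx; rewrite size_scale ?invr_eq0 ?lead_coef_eq0 // sp.
by apply: min_n; apply/asboolP; exists q.
Qed.

Lemma subfield_alg_closure : subfield (alg_closure E).
Proof.
split; rewrite ?inE.
- by apply/algebraic_overE; apply: algebraic1.
- move=> x y; rewrite !inE => /algebraic_overE ax /algebraic_overE ay.
  by apply/algebraic_overE; apply: algebraic_sub.
- move=> x y; rewrite !inE => /algebraic_overE ax /algebraic_overE ay.
  by apply/algebraic_overE; apply: algebraic_div.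
Qed.

End SubfieldType.

(** Over a field, algebraic means integral, and a root of a nonzero polynomial with integral
    coefficients is integral. *)
Lemma alg_closure_trans (L : fieldType) (E M : set L) :
  subfield E -> subfield M -> M `<=` alg_closure E ->
  alg_closure M `<=` alg_closure E.
Proof.
move=> hE hM ME x [p [pM p0 px]]; apply/(algebraic_overE hE).
apply/integral_algebraic; apply: (integral_root p0 px) => y.
move=> /(nthP 0) [i _ <-]; apply/integral_algebraic/algebraic_overE/ME.
exact/(polyOver_coefP hM).
Qed.

Lemma sub_polyOver (L : fieldType) (E M : set L) (p : {poly L}) :
  E `<=` M -> p \is a polyOver (mem E) -> p \is a polyOver (mem M).
Proof. by move=> EM; apply: polyOverS => x; rewrite !inE; exact: EM. Qed.

(** The minimal polynomial over [M] divides the one over [E], and divisors of separable polynomials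
    are separable. *)
Lemma sub_sep_closure (L : fieldType) (E M : set L) :
  subfield M -> E `<=` M -> sep_closure E `<=` sep_closure M.
Proof.
move=> hM EM x [q [qE q_monic qx _] q_sep].
have qM := sub_polyOver EM qE.
have [p p_min] : exists p, is_minpoly M x p.
  by apply: is_minpoly_exists => //; exists q; split; rewrite ?monic_neq0.
exists p => //; apply: dvdp_separable q_sep.
exact: (is_minpoly_dvdp hM p_min).
Qed.

Lemma subfield_adjoin (L : fieldType) (E S : set L) : subfield (adjoin E S).
Proof.
split; rewrite ?inE.
- by move=> M [[M1 _ _] _]; rewrite inE in M1.
- move=> x y; rewrite !inE => ax ay M hM; have [[_ MB _] _] := hM.
  by have := MB x y; rewrite !inE; apply; [apply: ax|apply: ay].
- move=> x y; rewrite !inE => ax ay M hM; have [[_ _ MD] _] := hM.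
  by have := MD x y; rewrite !inE; apply; [apply: ax|apply: ay].
Qed.

(** * Determinants and the fixed elements of a group of automorphisms *)

Lemma subfield_mxP (L : fieldType) (E : set L) (hE : subfield E) (m n : nat)
    (A : 'M[L]_(m, n)) :
  (forall i j, E (A i j)) ->
  exists A' : 'M[subfield_type hE]_(m, n), A = map_mx val A'.
Proof.
move=> AE; exists (map_mx (insubd (0 : subfield_type hE)) A).
by apply/matrixP => i j; rewrite !mxE val_insubd in_subfieldE mem_set.
Qed.

(** Subtracting from the first column the combination of the others with coefficients [c] clears [u]
    and leaves the Schur complement in the corner. *)
Lemma det_bordered (L : fieldType) (k : nat) (a : L) (v : 'rV[L]_k)
    (u : 'cV[L]_k) (B : 'M[L]_k) : B \in unitmx ->
  \det (block_mx a%:M v u B) = (a - (v *m (invmx B *m u)) 0 0) * \det B.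
Proof.
move=> uB; set c := invmx B *m u.
have -> : \det (block_mx a%:M v u B) =
    \det (block_mx a%:M v u B *m block_mx 1%:M 0 (- c) 1%:M).
  by rewrite det_mulmx det_lblock !det1 !mulr1.
rewrite mulmx_block !mulmx0 !mulmx1 !add0r !mulmxN /c mulKVmx // subrr.
by rewrite det_ublock det_mx11 !mxE eqxx.
Qed.

(* Artin's argument by determinants: take k maximal such that some k x k matrix
   (s_i (x_j)) is invertible. Bordering it by any s and y gives a singular
   matrix, so s y is a combination of the s x_j whose coefficients do not depend
   on s; being unique, they are fixed by D, and by Cramer's rule they lie in C. *)
Lemma fixed_span (L : fieldType) (C T : set L) (D : set (L -> L)) (m : nat) :
    subfield C -> T `<=` C ->
    (forall s, D s -> exists f : {rmorphism L -> L}, s = f) ->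
    (forall s x, D s -> C x -> C (s x)) ->
    D idfun ->
    (forall s t, D s -> D t -> D (s \o t)) ->
    (forall s, D s -> exists2 t, D t & cancel t s) ->
    (forall k (s : 'I_k -> L -> L), (forall i, D (s i)) ->
      (forall i j, (forall x, T x -> s i x = s j x) -> i = j) -> (k <= m)%N) ->
  exists (n : nat) (b : 'I_n -> L),
    (forall i, T (b i)) /\
    (forall x, T x -> exists2 c : 'I_n -> L,
       (forall i, C (c i) /\ forall s, D s -> s (c i) = c i)
       & x = \sum_i c i * b i).
Proof.
move=> hC TC Dmorph DC D1 DM DV Dbound.
pose P k := `[< exists (s : 'I_k -> L -> L) (x : 'I_k -> L),
  [/\ forall i, D (s i), forall i, T (x i)
    & \det (\matrix_(i, j) s i (x j)) != 0] >].
have exP : exists k, P k.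
  exists 0%N; apply/asboolP; exists (fun=> idfun), (fun=> 0).
  by split; [case|case|rewrite det_mx00 oner_neq0].
have P_le k : P k -> (k <= m)%N.
  (* Two of the [s i] agreeing on [T] would give equal rows. *)
  move=> /asboolP [s [x [Ds Tx det_neq0]]]; apply: Dbound Ds _ => i j sij.
  apply: contraNeq det_neq0 => neq_ij; apply/eqP.
  by apply: (determinant_alternate neq_ij) => l; rewrite !mxE sij.
case: (ex_maxnP exP P_le) => k /asboolP [s [x [Ds Tx]]].
set B := \matrix_(i, j) _ => det_neq0 max_k.
have uB : B \in unitmx by rewrite unitmxE unitfE.
pose u y : 'cV[L]_k := \col_i s i y.
pose c y := invmx B *m u y.
have span t y : D t -> T y -> t y = \sum_j t (x j) * c y j 0.
  move=> Dt Ty; apply/eqP; rewrite -subr_eq0; apply/contraT => neq0.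
  suff: P k.+1 by move/max_k; rewrite ltnn.
  (* The border comes first: the new index carries [t] as a row and [y] as a column. The corner
     factor in [det_bordered] is then the difference assumed nonzero. *)
  pose s' (i : 'I_(1 + k)) := if fintype.split i is inr i' then s i' else t.
  pose x' (i : 'I_(1 + k)) := if fintype.split i is inr i' then x i' else y.
  pose A := block_mx (t y)%:M (\row_j t (x j)) (u y) B.
  have AE : A = \matrix_(i, j) s' i (x' j).
    apply/matrixP => i j; rewrite [A i j]mxE [RHS]mxE /s' /x'.
    by case: (fintype.split i) => i'; rewrite mxE;
      case: (fintype.split j) => j'; rewrite ?mxE // !ord1 eqxx.
  have A_neq0 : \det A != 0.
    rewrite det_bordered // mulf_neq0 //; move: neq0.
    by rewrite mxE; under [in X in _ -> X]eq_bigr do rewrite mxE.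
  rewrite AE in A_neq0; apply/asboolP; exists s', x'.
  by split=> // i; rewrite /s' /x'; case: fintype.split.
exists k, x; split=> // y Ty; exists (fun j => c y j 0); last first.
  by rewrite [LHS](span idfun) //; apply: eq_bigr => j _; rewrite mulrC.
move=> j; split.
  have [B' B'E] : exists B' : 'M[subfield_type hC]_k, B = map_mx val B'.
    by apply: subfield_mxP => i l; rewrite mxE; apply/DC/TC.
  have [u' u'E] : exists u' : 'cV[subfield_type hC]_k, u y = map_mx val u'.
    by apply: subfield_mxP => i l; rewrite mxE; apply/DC/TC.
  rewrite /c B'E u'E -map_invmx -map_mxM mxE -inE.
  exact: (valP ((invmx B' *m u') j 0)).
move=> t Dt; have [t' Dt' t'K] := DV t Dt.
suff tc : map_mx t (c y) = c y by have /matrixP/(_ j 0) := tc; rewrite mxE.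
have [f tf] := Dmorph t Dt.
(* Applying [t] to the expansion of [(t' \o s i) y] gives back [s i y], with the coefficients moved
   by [t]. So [map_mx t (c y)] solves the same invertible system as [c y]. *)
suff Btc : B *m map_mx t (c y) = u y.
  by rewrite -[LHS](mulKmx uB) Btc.
apply/matrixP => i l; rewrite !mxE -(t'K (s i y)).
have -> : t' (s i y) = (t' \o s i) y by [].
rewrite (span (t' \o s i)) //; last exact: DM.
rewrite tf rmorph_sum; apply: eq_bigr => q _; rewrite rmorphM -tf mxE /=.
by rewrite t'K !mxE ord1.
Qed.

(** * Automorphisms and decomposition groups *)

Lemma rmorphism_of (L : fieldType) (s : L -> L) :
    (forall x y, s (x + y) = s x + s y) ->
    (forall x y, s (x * y) = s x * s y) -> s 1 = 1 ->
  exists f : {rmorphism L -> L}, s = f.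
Proof.
move=> sD sM s1.
have s0 : s 0 = 0 by apply: (@addrI _ (s 0)); rewrite -sD !addr0.
have sB x y : s (x - y) = s x - s y.
  by apply/eqP; rewrite -subr_eq opprK -sD subrK.
pose s_add := GRing.isZmodMorphism.Build L L s sB.
pose s_mul := GRing.isMonoidMorphism.Build L L s (s1, sM).
by pose f : {rmorphism L -> L} := HB.pack s s_add s_mul; exists f.
Qed.

Lemma root_fixing_rmorphism (L : fieldType) (E : set L)
    (f : {rmorphism L -> L}) (q : {poly L}) (x : L) :
    subfield E -> (forall y, E y -> f y = y) ->
  q \is a polyOver (mem E) -> root q x -> root q (f x).
Proof.
move=> hE fE /(polyOver_coefP hE) qE /(rmorph_root f).
suff -> : map_poly f q = q by [].
by apply/polyP => i; rewrite coef_map /= fE.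
Qed.

Section DecompositionGroup.
Variables (L : closedFieldType) (G : orderedZmodType) (w : valuation L G).
Implicit Types (E M F : set L).

(** When the algebraic closure is all of [L], elements of the group are true automorphisms of [L],
    so the groups of different base fields can be compared as sets of functions. *)
Lemma decomposition_groupP E (s : L -> L) : alg_closure E = [set: L] ->
  decomposition_group w E s <->
  [/\ injective s, (forall y, exists x, s x = y),
      (forall x y, s (x + y) = s x + s y)
    & [/\ (forall x y, s (x * y) = s x * s y),
      (forall x, E x -> s x = x) & (forall x, w (s x) = w x)]].
Proof.
rewrite /decomposition_group /galois_group /= => ->; split.
  move=> [[[_ s_inj s_surj] sD sM sE] sw]; split.
  - by move=> x y; apply: s_inj; rewrite inE.
  - by move=> y; have [x _ <-] := s_surj y I; exists x.
  - by move=> x y; apply: sD.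
  - by split=> // x *; [apply: sM|apply: sw].
move=> [s_inj s_surj sD [sM sE sw]]; split=> //; split=> //; split=> //.
- by move=> x y _ _; apply: s_inj.
- by move=> y _; have [x <-] := s_surj y; exists x.
Qed.

Lemma decomposition_group1 E : alg_closure E = [set: L] ->
  decomposition_group w E idfun.
Proof.
by move=> hE; apply/decomposition_groupP => //; split=> // y; exists y.
Qed.

Lemma decomposition_groupM E s t : alg_closure E = [set: L] ->
  decomposition_group w E s -> decomposition_group w E t ->
  decomposition_group w E (s \o t).
Proof.
move=> hE /(decomposition_groupP _ hE) [s_inj s_surj sD [sM sE sw]].
move=> /(decomposition_groupP _ hE) [t_inj t_surj tD [tM tE tw]].
apply/decomposition_groupP => //; split=> /= [|z|x y|].
- exact: inj_comp.
- by have [y <-] := s_surj z; have [x <-] := t_surj y; exists x.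
- by rewrite tD sD.
split=> [x y|x Ex|x]; first by rewrite tM sM.
- by rewrite tE ?sE.
- by rewrite sw tw.
Qed.

Lemma decomposition_groupV E s : alg_closure E = [set: L] ->
  decomposition_group w E s ->
  exists2 t, decomposition_group w E t & cancel t s.
Proof.
move=> hE /(decomposition_groupP _ hE) [s_inj s_surj sD [sM sE sw]].
have [t tK] := choice s_surj; exists t => //.
apply/decomposition_groupP => //; split=> [x y txy|x|x y|].
- by rewrite -(tK x) txy tK.
- by exists (s x); apply: s_inj; rewrite tK.
- by apply: s_inj; rewrite sD !tK.
split=> [x y|x Ex|x].
- by apply: s_inj; rewrite sM !tK.
- by apply: s_inj; rewrite tK sE.
- by rewrite -sw tK.
Qed.

Lemma decomposition_group_rmorphism E s :
    subfield E -> alg_closure E = [set: L] -> decomposition_group w E s ->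
  exists f : {rmorphism L -> L}, s = f.
Proof.
move=> [E1 _ _] hE /(decomposition_groupP _ hE) [_ _ sD [sM sE _]].
by apply: rmorphism_of => //; apply: sE; rewrite -inE.
Qed.

Lemma decomposition_groupS M F : M `<=` F ->
    alg_closure M = [set: L] -> alg_closure F = [set: L] ->
  decomposition_group w F `<=` decomposition_group w M.
Proof.
move=> MF hM hF s /(decomposition_groupP _ hF) [? ? ? [? sF ?]].
by apply/decomposition_groupP => //; split=> //; split=> // x /MF /sF.
Qed.

(* An element of the decomposition group of M is determined, up to that of F,
   by the images of a finite spanning family of F|M, and each of these is one
   of finitely many conjugates. *)
Lemma decomposition_group_index M F :
    subfield M -> finite_ext M F ->
    alg_closure M = [set: L] -> alg_closure F = [set: L] ->
  exists m, forall k (s : 'I_k -> L -> L),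
    (forall i, decomposition_group w M (s i)) ->
    (forall i j, (forall x, (forall t, decomposition_group w F t -> t x = x) ->
       s i x = s j x) -> i = j) -> (k <= m)%N.
Proof.
move=> hM [MF [n [b [bF b_span]]]] algM algF.
have /choice [r rP] l : exists r : seq L,
    forall s, decomposition_group w M s -> s (b l) \in r.
  have [q [qM q0 qb]] : alg_closure M (b l) by rewrite algM.
  (* [L] is algebraically closed, so [r] lists all roots of [q]; [s] fixes [M] and hence sends [b l]
     to one of them. *)
  have [r q_eq] := closed_field_poly_normal q.
  exists r => s Ds; have [f sf] := decomposition_group_rmorphism hM algM Ds.
  have : root q (s (b l)).
    rewrite sf; apply: root_fixing_rmorphism hM _ qM qb => x Mx.
    by rewrite -sf; have [_ _ _ [_ ->]] := (decomposition_groupP s algM).1 Ds.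
  by rewrite q_eq rootZ ?lead_coef_eq0 // root_prod_XsubC.
pose N := (\max_l size (r l))%N.
exists #|{ffun 'I_n -> 'I_N.+1}| => k s Ds s_inj.
(* Each automorphism is encoded by the positions of the images of the [b l] in the root lists; [N]
   bounds all their lengths. *)
pose g i : {ffun 'I_n -> 'I_N.+1} :=
  [ffun l => inord (index (s i (b l)) (r l))].
suff g_inj : injective g by rewrite -{1}(card_ord k); apply: leq_card g_inj.
have index_le i l : (index (s i (b l)) (r l) < N.+1)%N.
  by rewrite ltnS (leq_trans (index_size _ _)) // leq_bigmax.
move=> i j gij; apply: s_inj => x Fx.
have sb l : s i (b l) = s j (b l).
  have /(congr1 (@nat_of_ord _)) := congr1 (fun h : {ffun _} => h l) gij.
  rewrite !ffunE !inordK // => /(congr1 (nth 0 (r l))).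
  by rewrite !nth_index ?rP.
(* With [t] inverse to [s j], the map [t \o s i] fixes [M] and every [b l], hence [F]. It therefore
   fixes [x], which gives [s i x = s j x]. *)
have [t Dt tK] := decomposition_groupV algM (Ds j).
have DMts := decomposition_groupM algM Dt (Ds i).
suff : decomposition_group w F (t \o s i).
  by move=> /Fx /= /(congr1 (s j)); rewrite tK.
apply/decomposition_groupP => //.
have [? ? ? [? _ ?]] := (decomposition_groupP _ algM).1 DMts.
split=> //; split=> // y /b_span [c cM ->].
have [sj_inj _ _ [_ sjM _]] := (decomposition_groupP _ algM).1 (Ds j).
have [_ _ _ [_ siM _]] := (decomposition_groupP _ algM).1 (Ds i).
apply: sj_inj; rewrite /= tK.
have [f si_f] := decomposition_group_rmorphism hM algM (Ds i).
have [h sj_h] := decomposition_group_rmorphism hM algM (Ds j).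
rewrite si_f sj_h !rmorph_sum; apply: eq_bigr => l _.
by rewrite !rmorphM -si_f -sj_h sb (siM _ (cM l)) (sjM _ (cM l)).
Qed.

Lemma finite_ext_implicit_constant_field K M F :
    subfield K -> subfield M -> subfield F -> perfect K -> K `<=` M ->
    finite_ext M F -> F `<=` alg_closure M -> alg_closure F = [set: L] ->
  finite_ext (implicit_constant_field w K M) (implicit_constant_field w K F).
Proof.
move=> hK hM hF perfK KM finF algFM algF.
have [MF _] := finF.
have algM : alg_closure M = [set: L].
  apply/seteqP; split=> // x _.
  by apply: (alg_closure_trans hM hF algFM); rewrite algF.
split.
  (* A larger base field has a smaller decomposition group, so more elements are fixed. *)
  move=> x [Kx [Mx Dx]]; split=> //; split; first exact: sub_sep_closure Mx.
  by move=> s /(decomposition_groupS MF algM algF); apply: Dx.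
set T := implicit_constant_field w K F.
have [m Dm] := decomposition_group_index hM finF algM algF.
have [||||||||k [b [bT b_span]]] :=
    @fixed_span L (alg_closure K) T (decomposition_group w M) m.
- exact: subfield_alg_closure.
- by move=> x [].
- by move=> s; apply: decomposition_group_rmorphism.
(* Since [s] fixes [K], it maps roots of a polynomial over [K] to roots of the same polynomial. *)
- move=> s x Ds [q [qK q0 qx]]; exists q; split=> //.
  have [f sf] := decomposition_group_rmorphism hM algM Ds.
  rewrite sf; apply: root_fixing_rmorphism hK _ qK qx => y /KM My.
  by rewrite -sf; have [_ _ _ [_ ->]] := (decomposition_groupP s algM).1 Ds.
- exact: decomposition_group1.
- by move=> s t; apply: decomposition_groupM.
- by move=> s; apply: decomposition_groupV.
(* Elements of [T] are fixed by the decomposition group of [F], so maps agreeing on all such fixed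
   elements agree on [T]. *)
- move=> k s Ds s_inj; apply: Dm Ds _ => i j sij; apply: s_inj => x [_ [_ Fx]].
  exact: sij.
exists k, b; split=> // x /b_span [c cP ->]; exists c => // i.
have [Kc Dc] := cP i; split=> //; split=> //.
(* Perfectness enters here: the coefficients, algebraic over [K], are separable over [K] and so over
   [M], as [henselization] demands. *)
exact/(sub_sep_closure hM KM)/perfK.
Qed.

End DecompositionGroup.

Theorem proposition8p6
    (Fbar : closedFieldType) (G : orderedZmodType) (w : valuation Fbar G)
    (K F : set Fbar) (p : nat) (X : Fbar)
    (hp : p \in [pchar Fbar]) (hp_odd : odd p)
    (hFK : function_field_one K F)
    (hFbar : alg_closure F = [set: Fbar])
    (hperfect : perfect K)
    (hrank : rank_one w K)
    (himm : immediate w K F)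
    (hKr : K = ramification_field w K)
    (hXF : F X) (hXK : ~ K X)
    (hX : separating_element K F X) :
  let I := implicit_constant_field w K (adjoin K [set X]) in
  let Itilde := implicit_constant_field w K F in
  finite_ext I Itilde.
Proof.
have [hK hF KF _ _] := hFK; have [_ _ finF sepF] := hX.
apply: finite_ext_implicit_constant_field => //.
- exact: subfield_adjoin.
- by move=> x Kx; apply: sub_gen_smallest; left.
- by move=> x /sepF [q [qM q_monic qx _] _]; exists q; rewrite monic_neq0.
Qed.
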